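(* Let $\mathbf k$ be an algebraically closed field of characteristic $p>0$ and $S=\mathbf k[x_1,\dots,x_n]$. An ideal $I\subseteq S$ is $\mathrm{GL}_n(\mathbf k)$-invariant if and only if $I=I_B$ for some finite subset $B\subseteq C(n,p)$, i.e. if and only if $I$ is a (finite) sum of carry ideals $I_{c,d}$.
   Context: $\mathrm{GL}_n(\mathbf k)$ acts on $S$ by $\mathbf k$-algebra automorphisms, $g=(g_{i,j})$ sending $x_i\mapsto \sum_k g_{k,i}x_k$; an ideal $I$ is invariant if $g\cdot I\subseteq I$ for all $g$. Base-$p$ expansion: $a=\sum_j a_jp^j$, $0\le a_j\le p-1$; for $d\ge1$, $M=\max\{j:d_j\ne0\}$. For a monomial $x^{\underline b}=x_1^{b_1}\cdots x_n^{b_n}$ of degree $d$, with $b_{i,j}$ the $j$-th base-$p$ digit of $b_i$, the carry pattern $c(\underline b)=(c_1,\dots,c_M)$ is defined by $\sum_{i=1}^n\sum_{0\le j<\ell}b_{i,j}p^j=c_\ell p^\ell+\sum_{0\le j<\ell}d_jp^j$ for $1\le\ell\le M$ (convention $c_i=0$ for $i<1$, $i>M$). $C(d,n,p)$ is the set of carry patterns of degree-$d$ monomials in $n$ variables, partially ordered componentwise, and $C(n,p)=\bigsqcup_{d\ge0}C(d,n,p)$. For $c\in C(d,n,p)$, the carry ideal $I_{c,d}$ is the ideal of $S$ generated by all monomials of degree $d$ whose carry pattern is $\le c$. For finite $B\subseteq C(n,p)$, writing $B_d=B\cap C(d,n,p)$, set $I_B=\sum_{d\ge0}\sum_{c\in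 B_d}I_{c,d}$. *)

(* Defs.v *)
From HB Require Import structures.
From mathcomp Require Import all_boot all_order all_algebra.
From mathcomp Require Export mpoly.
Set Implicit Arguments. Unset Strict Implicit. Unset Printing Implicit Defensive.
Import GRing.Theory.
Local Open Scope ring_scope.

Section Carry.
Variable p : nat.

Definition digit (a j : nat) : nat := ((a %/ p ^ j) %% p)%N.

Definition lowsum (a l : nat) : nat := (\sum_(j < l) digit a j * p ^ j)%N.

(* M = max { j : d_j <> 0 } (and 0 when d = 0; digits at index >= d vanish
   for p >= 2) *)
Definition topdigit (d : nat) : nat :=
  (\max_(j < d.+1 | digit d j != 0%N) (j : nat))%N.

(* carry pattern (c_1, ..., c_M) of the exponent vector b of a monomial of
   degree d = |b|: c_l is defined by
   sum_i sum_{j<l} b_{i,j} p^j = c_l p^l + sum_{j<l} d_j p^j *)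
Definition carry_pattern (n : nat) (b : 'X_{1..n}) : seq nat :=
  let d := mdeg b in
  [seq ((\sum_(i < n) lowsum (b i) l - lowsum d l) %/ p ^ l)%N
     | l <- iota 1 (topdigit d)].

Definition is_carry_pattern (n d : nat) (c : seq nat) : Prop :=
  exists b : 'X_{1..n}, mdeg b = d /\ carry_pattern b = c.

Definition carry_le (c c' : seq nat) : bool := all2 (fun x y => (x <= y)%N) c c'.

End Carry.

Section Ideals.
Variables (R : comUnitRingType) (n : nat).

Definition is_ideal (I : {mpoly R[n]} -> Prop) : Prop :=
  [/\ I 0, (forall f g, I f -> I g -> I (f + g)) &
      (forall f g, I g -> I (f * g))].

Definition ideal_gen (G : {mpoly R[n]} -> Prop) (f : {mpoly R[n]}) : Prop :=
  exists s : seq ({mpoly R[n]} * {mpoly R[n]}),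
    (forall q, q \in s -> G q.2) /\ f = \sum_(q <- s) q.1 * q.2.

Definition gl_act (g : 'M[R]_n) (f : {mpoly R[n]}) : {mpoly R[n]} :=
  f \mPo [tuple \sum_(k < n) g k i *: 'X_k | i < n].

Definition gl_invariant (I : {mpoly R[n]} -> Prop) : Prop :=
  forall g : 'M[R]_n, g \in unitmx -> forall f, I f -> I (gl_act g f).

Definition carry_ideal (p : nat) (c : seq nat) (d : nat) : {mpoly R[n]} -> Prop :=
  ideal_gen (fun f => exists b : 'X_{1..n},
    [/\ mdeg b = d, carry_le (carry_pattern p b) c & f = 'X_[b]]).

Definition I_B (p : nat) (B : seq (nat * seq nat)) : {mpoly R[n]} -> Prop :=
  ideal_gen (fun f => exists2 dc, dc \in B & carry_ideal p dc.2 dc.1 f).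

End Ideals.

(* Main.v *)
(** Write [w_l(b)] ([modsum p l b]) for the sum of the residues
    [b_i mod p^l].  For monomials of the same degree, [c(a) <= c(b)] means [w_l(a) <= w_l(b)] for all [l].

    Sums of carry ideals are invariant: [w_l] is subadditive, and writing
    [e = q p^l + r] with [r < p^l], the power [L^e] of a linear form is
    [(L^(p^l))^q L^r], where the first factor has [w_l = 0] by Frobenius.

    Conversely, the torus shows that an invariant ideal contains the monomials
    of its elements, and a transvection shows that it is stable under moving
    [p^j] units from a nonzero [j]-th digit of an exponent to another variable,
    since then ['C(b_i, p^j)] is nonzero mod [p].  Such moves lead from [b] to any
    [a] of the same degree with [w_l(a) <= w_l(b)] for all [l]: as long as
    [w_1(a) < w_1(b)], single units are pushed into a variable in which the
    resulting carry does no harm; once [w_1(a) = w_1(b)], the lowest digits can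
    be matched and everything is divided by [p].  Dickson's lemma makes the
    set of carry ideals finite. *)
Require Import Defs.
From HB Require Import structures.
From mathcomp Require Import all_boot all_order all_algebra.
From mathcomp Require Import mpoly.
From mathcomp Require Import zify.
From Stdlib Require Import Classical_Prop.
Set Implicit Arguments. Unset Strict Implicit. Unset Printing Implicit Defensive.
Import GRing.Theory.
Local Open Scope ring_scope.

(** * Residue sums and moves of exponent vectors *)

Definition modsum (p l n : nat) (b : 'X_{1..n}) : nat :=
  (\sum_(i < n) b i %% p ^ l)%N.

Lemma modsum_mod (p l n : nat) (b : 'X_{1..n}) :
  (modsum p l b = mdeg b %[mod p ^ l])%N.
Proof.
rewrite mdegE /modsum.
elim/big_rec2: _ => // i x y _ h.
by rewrite modnDml -modnDmr h modnDmr.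
Qed.

Lemma modsum_big (p l n : nat) (b : 'X_{1..n}) :
  (mdeg b < p ^ l)%N -> modsum p l b = mdeg b.
Proof.
move=> h; rewrite mdegE; apply: eq_bigr => i _; rewrite modn_small //.
by apply: leq_ltn_trans h; rewrite mdegE (bigD1 i) //= leq_addr.
Qed.

(* The equation says [b' = b - p^j e_i + p^j e_k], without truncated subtraction;
   the divisibility condition says that the [j]-th digit of [b i] is nonzero. *)
Definition move_closed (p n : nat) (R : 'X_{1..n} -> Prop) : Prop :=
  forall (b b' : 'X_{1..n}) (i k : 'I_n) (j : nat), i != k ->
    ~~ (p %| b i %/ p ^ j)%N ->
    (b' + U_(i) *+ p ^ j = b + U_(k) *+ p ^ j)%MM ->
    R b -> R b'.

Lemma mnm_move (n : nat) (b : 'X_{1..n}) (i k : 'I_n) : (0 < b i)%N ->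
  exists b' : 'X_{1..n}, (b' + U_(i) = b + U_(k))%MM.
Proof.
move=> bi; exists (b - U_(i) + U_(k))%MM; apply/mnmP => x.
by rewrite !mnmE; case: eqP => [<-|_]; lia.
Qed.

Lemma mnm_moveE (n : nat) (b b' : 'X_{1..n}) (i k : 'I_n) : i != k ->
  (b' + U_(i) = b + U_(k))%MM ->
  [/\ (b' i).+1 = b i, b' k = (b k).+1 & forall x, x != i -> x != k -> b' x = b x].
Proof.
move=> ik /mnmP e; split.
- by have := e i; rewrite !mnmE eqxx eq_sym (negPf ik); lia.
- by have := e k; rewrite !mnmE eqxx (negPf ik); lia.
- move=> x xi xk; have := e x; rewrite !mnmE.
  by rewrite eq_sym (negPf xi) eq_sym (negPf xk); lia.
Qed.

Lemma mdeg_move (n : nat) (b b' : 'X_{1..n}) (i k : 'I_n) :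
  (b' + U_(i) = b + U_(k))%MM -> mdeg b' = mdeg b.
Proof. by move=> /(congr1 mdeg); rewrite !mdegD !mdeg1 => /addIn. Qed.

(** The unit leaves a nonzero lowest digit, so that residue drops by one. It raises the residue of
    [b k] by one, unless [p ^ l] divides [(b k).+1]: then it falls from [p ^ l - 1] to 0. *)
Lemma modsum_move (p l n : nat) (b b' : 'X_{1..n}) (i k : 'I_n) :
  (0 < p)%N -> (0 < l)%N -> i != k -> ~~ (p %| b i)%N ->
  (b' + U_(i) = b + U_(k))%MM ->
  (modsum p l b' + (if p ^ l %| (b k).+1 then p ^ l else 0) = modsum p l b)%N.
Proof.
move=> p0 l0 ik pbi /(mnm_moveE ik)[ei ek ex].
rewrite /modsum (bigD1 i) //= [X in _ = X](bigD1 i) //=.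
have ki : k != i by rewrite eq_sym.
rewrite (bigD1 k) //= [X in _ = (_ + X)%N](bigD1 k) //= ek.
rewrite (eq_bigr (fun x => b x %% p ^ l)%N); last first.
  by move=> x /andP[xi xk]; rewrite ex.
have P0 : (0 < p ^ l)%N by rewrite expn_gt0 p0.
have -> : (b i %% p ^ l = (b' i %% p ^ l).+1)%N.
  rewrite -ei modnS ifN //; apply: contra pbi; rewrite -ei.
  by apply: dvdn_trans; rewrite dvdn_exp.
rewrite modnS; case: ifP => [h|_]; last by lia.
suff -> : (b k %% p ^ l = (p ^ l).-1)%N by lia.
have := divn_eq (b k).+1 (p ^ l); rewrite (eqP h) addn0 => e.
have q0 : (0 < (b k).+1 %/ p ^ l)%N by case: (_ %/ _)%N e.
have -> : b k = (((b k).+1 %/ p ^ l).-1 * p ^ l + (p ^ l).-1)%N.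
  by case: (_ %/ _)%N q0 e => // q _; rewrite mulSn /=; lia.
by rewrite modnMDl modn_small // prednK.
Qed.

Lemma modsum1_gt (p n : nat) (b : 'X_{1..n}) (k : 'I_n) :
  (b k %% p < modsum p 1 b)%N -> exists2 i, i != k & ~~ (p %| b i)%N.
Proof.
rewrite /modsum (bigD1 k) //= expn1 -[X in (X < _)%N]addn0 ltn_add2l => h.
apply/exists_inP; apply: contraTT h; rewrite negb_exists_in => /forall_inP h.
by rewrite -leqNgt leqn0 big1 // => i /h; rewrite negbK => /eqP.
Qed.

Lemma modsum0 (p n : nat) (b : 'X_{1..n}) : modsum p 0 b = 0%N.
Proof. by rewrite /modsum big1 // => i _; rewrite expn0 modn1. Qed.

(** Both sums are congruent to the common degree modulo [p ^ l]. The gap is thus large enough to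
    absorb one carry. *)
Lemma modsum_gap (p l n : nat) (a b : 'X_{1..n}) : mdeg a = mdeg b ->
  (modsum p l a < modsum p l b)%N -> (modsum p l a + p ^ l <= modsum p l b)%N.
Proof.
move=> dab lt; have le := ltnW lt.
suff : (p ^ l <= modsum p l b - modsum p l a)%N by lia.
apply: dvdn_leq; first by rewrite subn_gt0.
by rewrite -(eqn_mod_dvd _ le) !modsum_mod dab.
Qed.

(** Units are pushed into [k] until its lowest digit overflows. The last hypothesis confines the
    carry to levels at most [r], where the gap between [a] and [b] pays for it. *)
Lemma lower_modsum1_with (p n r : nat) (R : 'X_{1..n} -> Prop)
    (a b : 'X_{1..n}) (k : 'I_n) :
  (1 < p)%N -> (0 < r)%N -> move_closed p R -> R b -> mdeg a = mdeg b ->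
  (forall l, modsum p l a <= modsum p l b)%N ->
  (forall l, 0 < l <= r -> modsum p l a < modsum p l b)%N ->
  ~~ (p ^ r %| (b k %/ p).+1)%N ->
  exists b' : 'X_{1..n}, [/\ R b', mdeg b' = mdeg b,
    forall l, (modsum p l a <= modsum p l b')%N
    & (modsum p 1 b' < modsum p 1 b)%N].
Proof.
move=> p1 r0 Rcl; have p0 := ltnW p1.
have [u] := ubnP (p - b k %% p); elim: u b => // u IH b hu Rb dab le lt nk.
(* Hence [modsum p 1 b] is at least [p] and exceeds [b k %% p]: another variable can still give a
   unit. *)
have := modsum_gap dab (lt 1 r0); rewrite expn1 => gap1.
have kb : (b k %% p < modsum p 1 b)%N.
  by apply: leq_trans (ltn_pmod _ p0) (leq_trans _ gap1); apply: leq_addl.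
have [i ik pbi] := modsum1_gt kb.
have bi0 : (0 < b i)%N by rewrite lt0n; apply: contra pbi => /eqP->.
have [b' mv] := mnm_move k bi0.
have Rb' : R b' by apply: (Rcl b b' i k 0) => //; rewrite ?expn0 ?divn1 ?mulm1n.
have db' := mdeg_move mv.
have ms l := fun l0 => @modsum_move p l n b b' i k p0 l0 ik pbi mv.
have [pk|pk] := boolP (p %| (b k).+1)%N.
  exists b'; split=> //; last first.
    by have := ms 1%N isT; rewrite expn1 pk; lia.
  case=> [|l]; first by rewrite !modsum0.
  have := ms l.+1 isT; case: ifP => [h|_]; last by rewrite addn0 => ->.
  have lr : (l.+1 <= r)%N.
    rewrite leqNgt; apply: contra nk => rl.
    rewrite -(@dvdn_pmul2l p) // -expnS (dvdn_trans (dvdn_exp2l p rl)) //.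
    have -> : (p * (b k %/ p).+1 = (b k).+1)%N; last by [].
    have := divn_eq (b k).+1 p; rewrite (eqP pk) addn0 divnS // pk add1n => e.
    by rewrite mulnC -e.
  by have := modsum_gap dab (lt l.+1 lr); lia.
have ms' l : modsum p l b' = modsum p l b.
  case: l => [|l]; first by rewrite !modsum0.
  have := ms l.+1 isT; rewrite ifN ?addn0 //.
  by apply: contra pk; apply: dvdn_trans; rewrite dvdn_exp.
have [_ ek _] := mnm_moveE ik mv.
have := IH b'; rewrite ek divnS // (negPf pk) modnS (negPf pk) add0n.
have hu' : (p - (b k %% p).+1 < u)%N.
  by have := ltn_pmod (b k) p0; lia.
move=> /(_ hu' Rb').
rewrite db' ms'; apply=> //= l; rewrite ms'; [exact: le | exact: lt].
Qed.

Lemma modsumS (p l n : nat) (b : 'X_{1..n}) : (0 < p)%N ->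
  modsum p l.+1 b =
  (modsum p l [multinom (b i %/ p)%N | i < n] * p + modsum p 1 b)%N.
Proof.
move=> p0; rewrite /modsum big_distrl -big_split /=; apply: eq_bigr => i _.
rewrite mnmE expn1; move: (b i) => x.
have P0 : (0 < p ^ l)%N by rewrite expn_gt0 p0.
rewrite {1}(divn_eq x p) {1}(divn_eq (x %/ p) (p ^ l)) mulnDl -mulnA -expnSr.
rewrite -addnA modnMDl modn_small //.
move: (ltn_pmod x p0) (ltn_pmod (x %/ p) P0); rewrite expnSr.
move: (p ^ l)%N (x %% p)%N (x %/ p %% p ^ l)%N => q x2 x1 lx2 lx1.
apply: leq_trans (_ : (x1.+1 * p <= _)%N); first by rewrite mulSn; lia.
by rewrite leq_mul2r lx1 orbT.
Qed.

(** Otherwise every [b k %/ p] has the largest residue modulo [p ^ r], so the part of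
    [modsum p r.+1 b] above the lowest digits is at least that of [a]; with equality at level
    [r.+1], this contradicts the gap at level 1. *)
Lemma exists_low_variable (p n r : nat) (a b : 'X_{1..n}) : (0 < p)%N ->
  modsum p r.+1 a = modsum p r.+1 b -> (modsum p 1 a < modsum p 1 b)%N ->
  exists k, ~~ (p ^ r %| (b k %/ p).+1)%N.
Proof.
move=> p0 e lt1; apply/existsP; apply: contraTT lt1.
rewrite negb_exists -leqNgt => /forallP h.
suff le : (modsum p r [multinom (a i %/ p)%N | i < n] * p <=
           modsum p r [multinom (b i %/ p)%N | i < n] * p)%N.
  by move: e; rewrite !(@modsumS p r) //; lia.
rewrite leq_mul2r; apply/orP; right; apply: leq_sum => i _; rewrite !mnmE.
have P0 : (0 < p ^ r)%N by rewrite expn_gt0 p0.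
have /eqP bi : (p ^ r %| (b i %/ p).+1)%N by have := h i; rewrite negbK.
have ha := ltn_pmod (a i %/ p) P0.
suff -> : (b i %/ p %% p ^ r = (p ^ r).-1)%N by lia.
move: bi; rewrite -addn1 -modnDml; move: (ltn_pmod (b i %/ p) P0).
set x := (_ %% _)%N; rewrite leq_eqVlt => /orP[/eqP <- //|hx].
by rewrite modn_small addn1.
Qed.

Lemma lower_modsum1 (p n : nat) (R : 'X_{1..n} -> Prop) (a b : 'X_{1..n}) :
  (1 < p)%N -> move_closed p R -> R b -> mdeg a = mdeg b ->
  (forall l, modsum p l a <= modsum p l b)%N ->
  (modsum p 1 a < modsum p 1 b)%N ->
  exists b' : 'X_{1..n}, [/\ R b', mdeg b' = mdeg b,
    forall l, (modsum p l a <= modsum p l b')%N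
    & (modsum p 1 b' < modsum p 1 b)%N].
Proof.
move=> p1 Rcl Rb dab le lt1.
(* At high levels both sums equal the degree. The least [r] makes levels 1 to [r] strict; the shift
   skips the trivial level 0. *)
have ex : exists l, modsum p l.+1 a == modsum p l.+1 b.
  have dlt : (mdeg b < p ^ (mdeg b).+1)%N.
    by apply: ltn_trans (ltn_expl _ p1); rewrite // ltn_exp2l.
  by exists (mdeg b); rewrite !modsum_big // dab.
have [r er rmin] := ex_minnP ex.
have r0 : (0 < r)%N by rewrite lt0n; apply: contraTneq er => ->; rewrite neq_ltn lt1.
have [k nk] := exists_low_variable (ltnW p1) (eqP er) lt1.
apply: (lower_modsum1_with p1 r0 Rcl Rb dab le _ nk) => -[//|l] /= lr.
rewrite ltn_neqAle le andbT; apply: contraTN lr => e.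
by rewrite -leqNgt rmin.
Qed.

(** Units go from a lowest digit that is too large to one that is too small. No carry occurs, as the
    receiving digit is below [t k < p]. *)
Lemma move_units_mod (p n : nat) (R : 'X_{1..n} -> Prop) (t b : 'X_{1..n}) :
  (0 < p)%N -> move_closed p R -> R b -> (forall i, t i < p)%N ->
  mdeg t = modsum p 1 b ->
  R [multinom (b i %/ p * p + t i)%N | i < n].
Proof.
move=> p0 Rcl.
(* Truncated subtraction makes this the total surplus, which each move lowers by one. *)
have [u] := ubnP (\sum_(i < n) (b i %% p - t i))%N.
elim: u b => // u IH b hu Rb tp; rewrite mdegE /modsum.
under [in RHS]eq_bigr do rewrite expn1.
move=> e; case: (pickP (fun i => t i < b i %% p)%N) => [i hi|hle].
  have [k hk] : exists k, (b k %% p < t k)%N.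
    apply/existsP; apply: contra_eqT e; rewrite negb_exists => /forallP h.
    rewrite neq_ltn (bigD1 i) //= [X in (_ < X)%N](bigD1 i) //=.
    by rewrite -addSn leq_add // leq_sum // => x _; rewrite leqNgt h.
  have ik : i != k by apply: contraTneq hi => ->; rewrite -leqNgt ltnW.
  have bi0 : (0 < b i)%N by case: (b i) hi => //; rewrite mod0n.
  have [b' mv] := mnm_move k bi0; have [ei ek ex] := mnm_moveE ik mv.
  have pbi : ~~ (p %| b i)%N by apply: contraTN hi => /eqP ->.
  have Rb' : R b' by apply: (Rcl b b' i k 0) => //; rewrite ?expn0 ?divn1 ?mulm1n.
  have pk : (p %| (b k).+1)%N = false.
    apply/negbTE/negP => /eqP; rewrite -addn1 -modnDml addn1 modn_small //.
    exact: leq_ltn_trans hk (tp k).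
  have qi : (b' i %/ p = b i %/ p)%N.
    by rewrite -ei divnS // ei (negPf pbi).
  have mi : (b i %% p = (b' i %% p).+1)%N by rewrite -ei modnS ei (negPf pbi).
  have qk : (b' k %/ p = b k %/ p)%N by rewrite ek divnS // pk.
  have mk : (b' k %% p = (b k %% p).+1)%N by rewrite ek modnS pk.
  have -> : [multinom (b i %/ p * p + t i)%N | i < n] =
            [multinom (b' i %/ p * p + t i)%N | i < n].
    apply/mnmP => x; rewrite !mnmE; congr (_ * _ + _)%N.
    have [->//|xi] := eqVneq x i; have [->//|xk] := eqVneq x k.
    by rewrite ex.
  have ki : k != i by rewrite eq_sym.
  apply: IH => //.
    rewrite -ltnS; apply: leq_trans hu; rewrite ltnS.
    rewrite (bigD1 i) //= [X in (_ < X)%N](bigD1 i) //= -addSn.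
    apply: leq_add; first by lia.
    apply: leq_sum => x xi; have [->|xk] := eqVneq x k; last by rewrite ex.
    by rewrite mk; lia.
  rewrite mdegE e /modsum.
  rewrite (bigD1 i) //= (bigD1 k) //= [RHS](bigD1 i) //= [in RHS](bigD1 k) //=.
  rewrite expn1 mi mk addSn addnS -addSn; congr (_ + (_ + _))%N => //.
  by apply: eq_bigr => x /andP[xi xk]; rewrite ex.
(* Without surplus, equal totals force equal lowest digits. *)
suff -> : [multinom (b i %/ p * p + t i)%N | i < n] = b by [].
apply/mnmP => i; rewrite mnmE [RHS](divn_eq _ p); congr (_ + _)%N.
have le x : (b x %% p <= t x)%N by rewrite leqNgt hle.
have [_] := leqif_sum (fun x (_ : true) => leqif_eq (le x)).
by rewrite -e eqxx => /esym/forallP/(_ i)/eqP ->.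
Qed.

(** The inner induction on [modsum p 1 b] makes level 1 equal; the outer one on the degree handles
    the quotients by [p]. *)
Lemma move_reach (p n : nat) (R : 'X_{1..n} -> Prop) (a b : 'X_{1..n}) :
  (1 < p)%N -> move_closed p R -> R b -> mdeg a = mdeg b ->
  (forall l, modsum p l a <= modsum p l b)%N -> R a.
Proof.
move=> p1; have p0 := ltnW p1.
have [d] := ubnP (mdeg b); elim: d R a b => // d IHd R a b hd Rcl.
have [s] := ubnP (modsum p 1 b); elim: s b hd => // s IHs b hd hs Rb dab le.
have := le 1%N; rewrite leq_eqVlt => /orP[/eqP e1|lt1]; last first.
  have [b' [Rb' db' le' lt']] := lower_modsum1 p1 Rcl Rb dab le lt1.
  by apply: (IHs b') => //; rewrite ?db' //; apply: leq_trans lt' _.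
have mdegq (c : 'X_{1..n}) :
    mdeg c = (mdeg [multinom (c i %/ p)%N | i < n] * p + modsum p 1 c)%N.
  rewrite !mdegE big_distrl -big_split /=; apply: eq_bigr => i _.
  by rewrite mnmE expn1 -divn_eq.
(* In degree 0, division by [p] would not lower the degree. *)
have [b0|bpos] := eqVneq (mdeg b) 0%N.
  have /eqP := b0; rewrite mdeg_eq0 => /eqP eb.
  by move: dab; rewrite b0 => /eqP; rewrite mdeg_eq0 -eb => /eqP ->.
(* [R'] fixes the lowest digits to those of [a]; moving [p ^ j] units between quotients moves
   [p ^ j.+1] units for [R]. *)
pose t := [multinom (a i %% p)%N | i < n].
pose R' m := R [multinom (m i * p + t i)%N | i < n].
suff : R' [multinom (a i %/ p)%N | i < n].
  rewrite /R'; congr (R _); apply/mnmP => i; rewrite !mnmE.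
  by rewrite -divn_eq.
apply: (IHd R' _ [multinom (b i %/ p)%N | i < n]).
- have h := mdegq b; have : (mdeg b != 0)%N by []; rewrite h.
  by move: hd; rewrite h; nia.
- move=> m m' i k j ik nd mv; apply: (Rcl _ _ i k j.+1) => //.
    rewrite !mnmE expnS divnMA divnMDl // [X in (_ + X)%N]divn_small ?addn0 //.
    exact: ltn_pmod.
  apply/mnmP => x; have /mnmP/(_ x) := mv; rewrite !mnmE !mulmnE !mnmE expnS; nia.
- rewrite /R'.
  have -> : [multinom ([multinom (b i %/ p)%N | i < n] i * p + t i)%N | i < n] =
            [multinom (b i %/ p * p + t i)%N | i < n].
    by apply/mnmP => i; rewrite !mnmE.
  apply: move_units_mod => //; first by move=> i; rewrite mnmE ltn_pmod.
  by rewrite -e1 mdegE; apply: eq_bigr => i _; rewrite mnmE expn1.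
- by move: (mdegq a) (mdegq b); rewrite e1 dab; nia.
- by move=> l; have := le l.+1; rewrite !(@modsumS p l) // e1 leq_add2r leq_mul2r; lia.
Qed.

(** * Base-p digits and the order on carry patterns *)

Lemma lowsumE (p a l : nat) : (0 < p)%N -> lowsum p a l = (a %% p ^ l)%N.
Proof.
move=> p0; elim: l => [|l IH]; first by rewrite /lowsum big_ord0 expn0 modn1.
rewrite /lowsum big_ord_recr /= -/(lowsum p a l) IH /digit.
have P0 : (0 < p ^ l)%N by rewrite expn_gt0 p0.
have e : (a = a %/ p ^ l.+1 * p ^ l.+1
            + ((a %/ p ^ l) %% p * p ^ l + a %% p ^ l))%N.
  rewrite {1}(divn_eq a (p ^ l)) {1}(divn_eq (a %/ p ^ l) p) mulnDl -mulnA.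
  by rewrite -divnMA -expnS -expnSr addnA.
rewrite [in RHS]e modnMDl [RHS]modn_small; first by rewrite addnC.
move: (ltn_pmod a P0) (ltn_pmod (a %/ p ^ l) p0); rewrite expnS.
move: (a %% p ^ l)%N (_ %% p)%N => y x hy hx.
apply: leq_trans (_ : (x.+1 * p ^ l <= _)%N); first by rewrite mulSn; lia.
by rewrite leq_mul2r hx orbT.
Qed.

(** Indices up to [d] reach all nonzero digits, because [d < p ^ d.+1]; so cutting the expansion
    after the top digit loses nothing. *)
Lemma ltn_topdigit (p d : nat) : (1 < p)%N -> (d < p ^ (topdigit p d).+1)%N.
Proof.
move=> p1; have p0 := ltnW p1.
have e : d = lowsum p d d.+1.
  by rewrite lowsumE // modn_small // (ltn_trans (ltnSn d)) // ltn_expl.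
have lt : (topdigit p d < d.+1)%N.
  by rewrite ltnS; apply/bigmax_leqP => j _; rewrite -ltnS.
suff h : d = lowsum p d (topdigit p d).+1.
  by rewrite {1}h lowsumE // ltn_pmod // expn_gt0 p0.
rewrite {1}e /lowsum [RHS](big_ord_widen d.+1 (fun j => digit p d j * p ^ j)%N) //.
rewrite [RHS]big_mkcond; apply: eq_bigr => j _; case: ifP => // /negbT.
rewrite -leqNgt => ltj; have [->//|nz] := eqVneq (digit p d j) 0%N.
have := @leq_bigmax_cond _ (fun j : 'I_d.+1 => digit p d j != 0%N)
  (fun j => j : nat) j nz.
by rewrite -/(topdigit p d) leqNgt ltj.
Qed.

(** The low part of the degree is the remainder of [modsum p l b] modulo [p ^ l], which leaves the
    quotient as carry. *)
Lemma carry_patternE (p n : nat) (b : 'X_{1..n}) : (0 < p)%N ->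
  carry_pattern p b =
  [seq (modsum p l b %/ p ^ l)%N | l <- iota 1 (topdigit p (mdeg b))].
Proof.
move=> p0; apply: eq_map => l; rewrite lowsumE //.
have -> : (\sum_(i < n) lowsum p (b i) l = modsum p l b)%N.
  by apply: eq_bigr => i _; rewrite lowsumE.
rewrite -modsum_mod {1}(divn_eq (modsum p l b) (p ^ l)) addnK mulnK //.
by rewrite expn_gt0 p0.
Qed.

(** Equal degrees give equal remainders modulo [p ^ l], so comparing quotients compares the sums;
    above the top digit both sums equal the degree. *)
Lemma carry_leP (p n : nat) (a b : 'X_{1..n}) : (1 < p)%N -> mdeg a = mdeg b ->
  carry_le (carry_pattern p a) (carry_pattern p b) <->
  (forall l, modsum p l a <= modsum p l b)%N.
Proof.
move=> p1 dab; have p0 := ltnW p1; rewrite !carry_patternE // -dab /carry_le.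
set s := iota _ _.
have -> : all2 leq [seq (modsum p l a %/ p ^ l)%N | l <- s]
                   [seq (modsum p l b %/ p ^ l)%N | l <- s] =
          all (fun l => modsum p l a %/ p ^ l <= modsum p l b %/ p ^ l)%N s.
  by elim: s => //= l s ->.
split=> [/allP h l|h]; last by apply/allP => l _; apply: leq_div2r.
case: l => [|l]; first by rewrite !modsum0.
have [lT|Tl] := leqP l.+1 (topdigit p (mdeg a)).
  have /h le : l.+1 \in s by rewrite mem_iota add1n.
  rewrite (divn_eq (modsum p l.+1 a) (p ^ l.+1)).
  rewrite (divn_eq (modsum p l.+1 b) (p ^ l.+1)) !modsum_mod dab.
  by rewrite leq_add2r leq_mul2r le orbT.
have lt : (mdeg a < p ^ l.+1)%N.
  by apply: leq_trans (ltn_topdigit _ p1) _; rewrite leq_exp2l.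
by rewrite !modsum_big -?dab.
Qed.

Lemma carry_le_trans (c1 c2 c3 : seq nat) :
  carry_le c1 c2 -> carry_le c2 c3 -> carry_le c1 c3.
Proof.
elim: c1 c2 c3 => [|x c1 IH] [|y c2] [|z c3] //= /andP[xy h1] /andP[yz h2].
by rewrite (leq_trans xy yz) (IH c2).
Qed.

(** * Ideals and generators *)

Lemma ideal_sum (R : comUnitRingType) (n : nat) (I : {mpoly R[n]} -> Prop)
    (T : eqType) (s : seq T) (F : T -> {mpoly R[n]}) :
  is_ideal I -> (forall x, x \in s -> I (F x)) -> I (\sum_(x <- s) F x).
Proof.
move=> [I0 ID _]; elim: s => [|x s IH] h; first by rewrite big_nil.
rewrite big_cons; apply: ID; first by apply: h; rewrite mem_head.
by apply: IH => y ys; apply: h; rewrite in_cons ys orbT.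
Qed.

Lemma idealZ (R : comUnitRingType) (n : nat) (I : {mpoly R[n]} -> Prop)
    (c : R) (f : {mpoly R[n]}) : is_ideal I -> I f -> I (c *: f).
Proof. by move=> [_ _ IM] If; rewrite -mul_mpolyC; apply: IM. Qed.

Lemma ideal_gen_ideal (R : comUnitRingType) (n : nat) (G : {mpoly R[n]} -> Prop) :
  is_ideal (ideal_gen G).
Proof.
split; first by exists [::]; rewrite big_nil.
- move=> f g [s [Gs ->]] [t [Gt ->]]; exists (s ++ t); rewrite big_cat; split=> //.
  by move=> q; rewrite mem_cat => /orP[/Gs|/Gt].
- move=> f g [s [Gs ->]]; exists [seq (f * q.1, q.2) | q <- s]; split.
    by move=> _ /mapP[q qs ->]; exact: (Gs q).
  by rewrite big_map mulr_sumr; apply: eq_bigr => q _; rewrite mulrA.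
Qed.

Lemma mem_ideal_gen (R : comUnitRingType) (n : nat) (G : {mpoly R[n]} -> Prop)
    (f : {mpoly R[n]}) : G f -> ideal_gen G f.
Proof.
move=> Gf; exists [:: (1, f)]; rewrite big_seq1 mul1r; split=> // q.
by rewrite inE => /eqP ->.
Qed.

Lemma ideal_gen_sub (R : comUnitRingType) (n : nat) (G I : {mpoly R[n]} -> Prop)
    (f : {mpoly R[n]}) :
  is_ideal I -> (forall g, G g -> I g) -> ideal_gen G f -> I f.
Proof.
move=> idI GI [s [Gs ->]]; apply: ideal_sum => // q qs.
by case: idI => _ _ IM; apply/IM/GI/Gs.
Qed.

(** * The torus action: invariant ideals are monomial *)

Lemma closed_field_separating (k : closedFieldType) (u v : nat) : u != v ->
  exists2 t : k, t != 0 & t ^+ u != t ^+ v.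
Proof.
move=> uv; have nz : 'X * ('X^u - 'X^v) != 0 :> {poly k}.
  rewrite mulf_neq0 ?polyX_eq0 // subr_eq0; apply: contra uv => /eqP.
  by move=> /(congr1 (fun q : {poly k} => size q)); rewrite !size_polyXn => -[->].
have /closed_nonrootP [t] := nz.
rewrite /root !hornerE mulf_eq0 negb_or subr_eq0 => /andP[t0 tuv].
by exists t.
Qed.

Lemma gl_act_diag (R : comUnitRingType) (n : nat) (t : 'rV[R]_n)
    (f : {mpoly R[n]}) (m : 'X_{1..n}) :
  (gl_act (diag_mx t) f)@_m = (\prod_(i < n) t 0 i ^+ m i) * f@_m.
Proof.
have act (b : 'X_{1..n}) : 'X_[b] \mPo [tuple \sum_(x < n) diag_mx t x i *: 'X_x | i < n]
    = (\prod_(i < n) t 0 i ^+ b i) *: 'X_[b] :> {mpoly R[n]}.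
  rewrite comp_mpolyX.
  transitivity (\prod_(i < n) ((t 0 i ^+ b i) *: ('X_i ^+ b i)) : {mpoly R[n]}).
    apply: eq_bigr => i _; rewrite tnth_mktuple (bigD1 i) //= big1 ?addr0.
      by rewrite mxE eqxx mulr1n exprZn.
    by move=> x xi; rewrite mxE (negPf xi) mulr0n scale0r.
  by rewrite scaler_prod -mpolyXE_id.
rewrite /gl_act comp_mpolyEX raddf_sum /=.
have [ms|ms] := boolP (m \in msupp f).
  rewrite (bigD1_seq m) ?msupp_uniq //= act !mcoeffZ mcoeffX eqxx mulr1 mulrC.
  rewrite [X in _ + X]big1 ?addr0 // => x xm.
  by rewrite act !mcoeffZ mcoeffX (negPf xm) !mulr0.
rewrite memN_msupp_eq0 // mulr0 big_seq big1 // => x xs.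
rewrite act !mcoeffZ mcoeffX (_ : x == m = false) ?mulr0 //.
by apply: contraNF ms => /eqP <-.
Qed.

(* [t . f - t^(m' i) f], for [t] scaling the variable [i], keeps [m] and kills
   [m']. *)
Lemma gl_invariant_monomial (k : closedFieldType) (n : nat)
    (I : {mpoly k[n]} -> Prop) (f : {mpoly k[n]}) (m : 'X_{1..n}) :
  is_ideal I -> gl_invariant I -> I f -> m \in msupp f -> I 'X_[m].
Proof.
move=> idI inv; have [s] := ubnP (size (msupp f)).
elim: s f => // s IH f hs If mf.
have [/hasP[m' m'f mm']|/hasPn hm] := boolP (has (fun x => x != m) (msupp f)).
  have [i mi] : exists i, m i != m' i.
    apply/existsP; apply: contraR mm'; rewrite negb_exists => /forallP h.
    by apply/eqP/mnmP => i; apply/esym/eqP; have := h i; rewrite negbK.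
  have [t t0 tm] := closed_field_separating k mi.
  pose d : 'rV[k]_n := \row_j (if j == i then t else 1).
  have dE (x : 'X_{1..n}) : \prod_(j < n) d 0 j ^+ x j = t ^+ x i.
    rewrite (bigD1 i) //= mxE eqxx big1 ?mulr1 // => j ji.
    by rewrite mxE (negPf ji) expr1n.
  have du : diag_mx d \in unitmx.
    rewrite unitmxE det_diag unitfE; apply/prodf_neq0 => j _.
    by rewrite mxE; case: ifP => // _; rewrite oner_neq0.
  pose h := gl_act (diag_mx d) f + (- t ^+ m' i) *: f.
  have Ih : I h.
    by case: (idI) => _ ID _; apply: ID; [apply: inv | apply: idealZ].
  have hE x : h@_x = (t ^+ x i - t ^+ m' i) * f@_x.
    by rewrite mcoeffD mcoeffZ gl_act_diag dE mulrBl mulNr.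
  apply: (IH h) => //; last first.
    by rewrite mcoeff_msupp hE mulf_neq0 // ?subr_eq0 // -mcoeff_msupp.
  rewrite -ltnS; apply: leq_trans hs; rewrite ltnS.
  have hsub : {subset msupp h <= rem m' (msupp f)}.
    move=> x; rewrite mcoeff_msupp hE mulf_eq0 negb_or => /andP[x1 x2].
    rewrite (rem_filter _ (msupp_uniq f)) mem_filter mcoeff_msupp x2 andbT /=.
    by apply: contraNneq x1 => ->; rewrite subrr.
  have := uniq_leq_size (msupp_uniq h) hsub; rewrite size_rem //.
  by case: (msupp f) m'f.
have fE : f = f@_m *: 'X_[m].
  rewrite {1}[f]mpolyE (bigD1_seq m) ?msupp_uniq //= big_seq_cond big1 ?addr0 //.
  by move=> x /andP[/hm]; rewrite negbK => /eqP ->; rewrite eqxx.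
have c0 : f@_m != 0 by rewrite -mcoeff_msupp.
have -> : 'X_[m] = (f@_m)^-1 *: f by rewrite {2}fE scalerA mulVf // scale1r.
exact: idealZ.
Qed.

(** * Transvections and binomial coefficients modulo p *)

(** Since [i C(p^j, i) = p^j C(p^j - 1, i - 1)], a coefficient prime to [p] would force [p ^ j] to
    divide [i]. *)
Lemma prime_dvd_bin_pow (p j i : nat) :
  prime p -> (0 < i < p ^ j)%N -> (p %| 'C(p ^ j, i))%N.
Proof.
move=> pp /andP[i0 ij]; apply: contraLR ij => nd; rewrite -leqNgt.
apply: dvdn_leq => //.
have cop : coprime (p ^ j) 'C(p ^ j, i) by rewrite coprimeXl // prime_coprime.
rewrite -(Gauss_dvdl _ cop).
by have := mul_bin_diag (p ^ j) i.-1; rewrite prednK // => <-; apply: dvdn_mulr.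
Qed.

(** A case of Lucas's theorem: in Vandermonde's identity for [C(p^j + x, p^j)] only the two end
    terms survive modulo [p], so each block of [p ^ j] adds one. *)
Lemma bin_pow_pchar (F : fieldType) (p j b : nat) : p \in [pchar F] ->
  'C(b, p ^ j)%:R = (b %/ p ^ j)%:R :> F.
Proof.
move=> hp; have pp := pcharf_prime hp.
have q0 : (0 < p ^ j)%N by rewrite expn_gt0 prime_gt0.
rewrite {1}(divn_eq b (p ^ j)); move: (_ %/ _)%N (ltn_pmod b q0) => u.
move: (b %% _)%N => r rq.
elim: u => [|u IH]; first by rewrite mul0n add0n bin_small.
rewrite mulSn -addnA -binomial.Vandermonde natr_sum.
move: q0 IH (fun i => @prime_dvd_bin_pow p j i pp) rq; case: (p ^ j)%N => // q _ IH dv rq.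
rewrite big_ord_recl big_ord_recr /= bin0 mul1n subn0 IH.
rewrite big1 ?add0r => [|i _].
  by rewrite /bump leq0n add1n binn subnn bin0 -natrD addn1.
rewrite /bump leq0n add1n natrM; apply/eqP; rewrite mulf_eq0 -(dvdn_pcharf hp).
by rewrite dv //= ltnS.
Qed.

Lemma transvection_unit (R : comUnitRingType) (n : nat) (i k : 'I_n) : i != k ->
  1%:M + delta_mx k i \in (unitmx : pred 'M[R]_n).
Proof.
move=> ik; have := @mulmx1_unit R n (1%:M + delta_mx k i) (1%:M - delta_mx k i).
case=> //; rewrite mulmxBr mulmx1 mulmxDl mul1mx mul_delta_mx_cond.
by rewrite (negPf ik) mulr0n addr0 addrK.
Qed.

(** The matrix sends [x_i] to [x_i + x_k] and fixes the other variables; [b'] arises by choosing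
    [x_k] in [q] of the [b i] factors. *)
Lemma gl_act_transvection (R : comUnitRingType) (n : nat) (i k : 'I_n)
    (b b' : 'X_{1..n}) (q : nat) : i != k -> (q <= b i)%N ->
  (b' + U_(i) *+ q = b + U_(k) *+ q)%MM ->
  (gl_act (1%:M + delta_mx k i) ('X_[b] : {mpoly R[n]}))@_b' = 'C(b i, q)%:R.
Proof.
move=> ik qb mv; rewrite /gl_act comp_mpolyX.
have act l : tnth [tuple \sum_(x < n) (1%:M + delta_mx k i) x l *: 'X_x | l < n] l
   = 'X_l + (l == i)%:R *: 'X_k :> {mpoly R[n]}.
  rewrite tnth_mktuple.
  under eq_bigr do rewrite !mxE scalerDl.
  rewrite big_split /=; congr (_ + _).
    rewrite (bigD1 l) //= eqxx scale1r big1 ?addr0 // => x xl.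
    by rewrite (negPf xl) scale0r.
  rewrite (bigD1 k) //= eqxx /= big1 ?addr0 // => x xk.
  by rewrite (negPf xk) scale0r.
pose c : 'X_{1..n} := [multinom (if l == i then 0 else b l)%N | l < n].
rewrite (bigD1 i) //= act eqxx scale1r.
have -> : \prod_(l < n | l != i)
    tnth [tuple \sum_(x < n) (1%:M + delta_mx k i) x l *: 'X_x | l < n] l ^+ b l
    = 'X_[c] :> {mpoly R[n]}.
  rewrite mpolyXE_id [RHS](bigD1 i) //= mnmE eqxx expr0 mul1r.
  apply: eq_bigr => l li.
  by rewrite act mnmE (negPf li) scale0r addr0.
rewrite exprDn mulr_suml raddf_sum /=.
have term (e : 'I_(b i).+1) :
    (('X_i ^+ (b i - e) * 'X_k ^+ e *+ 'C(b i, e)) * 'X_[c])@_b'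
    = ('C(b i, e) * (e == q :> nat))%:R :> R.
  rewrite mulrnAl mcoeffMn !mpolyXn -!mpolyXD mcoeffX -mulrnA mulnC.
  congr ((_ * _)%:R); congr nat_of_bool; apply/eqP/eqP => [/mnmP/(_ k)|eq].
    have /mnmP/(_ k) := mv; rewrite !mnmE !mulmnE !mnmE eqxx (negPf ik).
    by rewrite eq_sym (negPf ik) !mul1n !mul0n !add0n addn0; lia.
  apply/mnmP => x; have /mnmP/(_ x) := mv; rewrite eq !mnmE !mulmnE !mnmE.
  have [->|xi] := eqVneq x i; first by rewrite eq_sym (negPf ik); lia.
  by lia.
have qlt : (q < (b i).+1)%N by [].
under eq_bigr do rewrite term.
rewrite (bigD1 (Ordinal qlt)) //= eqxx muln1 big1 ?addr0 // => e ne.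
by rewrite (negPf (_ : e != q :> nat)) ?muln0.
Qed.

(** The moved monomial occurs in the transvected one with coefficient [b i %/ p ^ j], nonzero in
    [k]; the torus then isolates it. *)
Lemma gl_invariant_move_closed (k : closedFieldType) (p n : nat)
    (I : {mpoly k[n]} -> Prop) :
  p \in [pchar k] -> is_ideal I -> gl_invariant I ->
  move_closed p (fun b => I 'X_[b]).
Proof.
move=> hp idI inv b b' i x j ix nd mv Ib.
have qb : (p ^ j <= b i)%N.
  by rewrite leqNgt; apply: contra nd => /divn_small ->.
apply: (gl_invariant_monomial idI inv (inv _ (transvection_unit k ix) _ Ib)).
rewrite mcoeff_msupp (gl_act_transvection _ ix qb mv) (bin_pow_pchar _ _ hp).
by rewrite -(dvdn_pcharf hp).
Qed.

(** * Invariance of sums of carry ideals *)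

Definition homog_modsum (R : comUnitRingType) (p l n d s : nat)
    (f : {mpoly R[n]}) : Prop :=
  forall m, m \in msupp f -> mdeg m = d /\ (modsum p l m <= s)%N.

Lemma modsumD (p l n : nat) (a b : 'X_{1..n}) :
  (modsum p l (a + b) <= modsum p l a + modsum p l b)%N.
Proof.
rewrite /modsum -big_split; apply: leq_sum => i _ /=.
by rewrite mnmDE -modnDm leq_mod.
Qed.

Lemma homog_modsum_sum (R : comUnitRingType) (p l n d s : nat) (T : Type)
    (r : seq T) (F : T -> {mpoly R[n]}) :
  (forall x, homog_modsum p l d s (F x)) ->
  homog_modsum p l d s (\sum_(x <- r) F x).
Proof.
move=> h; elim: r => [|x r IH] m.
  by rewrite big_nil msupp0.
by rewrite big_cons => /msuppD_le; rewrite mem_cat => /orP[/h|/IH].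
Qed.

Lemma homog_modsumM (R : comUnitRingType) (p l n d s d' s' : nat)
    (f g : {mpoly R[n]}) :
  homog_modsum p l d s f -> homog_modsum p l d' s' g ->
  homog_modsum p l (d + d') (s + s') (f * g).
Proof.
move=> hf hg m /msuppM_le/allpairsP[[a b] /= [/hf[da sa] /hg[db sb] ->]].
split; first by rewrite mdegD da db.
by apply: leq_trans (modsumD _ _ _ _) _; apply: leq_add.
Qed.

Lemma homog_modsum1 (R : comUnitRingType) (p l n : nat) :
  homog_modsum p l 0 0 (1 : {mpoly R[n]}).
Proof.
move=> m; rewrite msupp1 inE => /eqP ->; rewrite mdeg0; split=> //.
by rewrite /modsum big1 // => i _; rewrite mnm0E mod0n.
Qed.

Lemma homog_modsumX (R : comUnitRingType) (p l n d s e : nat) (f : {mpoly R[n]}) :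
  homog_modsum p l d s f -> homog_modsum p l (e * d) (e * s) (f ^+ e).
Proof.
move=> hf; elim: e => [|e IH]; first by rewrite expr0; apply: homog_modsum1.
by rewrite exprS !mulSn; apply: homog_modsumM.
Qed.

Lemma homog_modsum_linearX (F : fieldType) (p l n e : nat) (c : 'I_n -> F) :
  p \in [pchar F] ->
  homog_modsum p l e (e %% p ^ l) ((\sum_(x < n) c x *: 'X_x : {mpoly F[n]}) ^+ e).
Proof.
move=> hp; have p0 := prime_gt0 (pcharf_prime hp).
set L := \sum_x _.
have hL : homog_modsum p l 1 1 L.
  apply: homog_modsum_sum => x m /msuppZ_le; rewrite msuppX inE => /eqP ->.
  rewrite mdeg1; split=> //; rewrite -(mdeg1 x) mdegE.
  by apply: leq_sum => i _; rewrite leq_mod.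
(* By Frobenius this power is a combination of the [x_i^(p^l)], whose exponents vanish modulo
   [p ^ l]. *)
have hLq : homog_modsum p l (p ^ l) 0 (L ^+ (p ^ l)).
  have hpM : p \in [pchar {mpoly F[n]}].
    by apply: (rmorph_pchar (mpolyC n (R := F))).
  have pn : [pchar {mpoly F[n]}].-nat (p ^ l)%N.
    by rewrite pnatX pnatE ?hpM ?(pcharf_prime hp).
  have -> : L ^+ (p ^ l) = \sum_(x < n) c x ^+ (p ^ l) *: 'X_[U_(x) *+ (p ^ l)].
    rewrite /L (big_morph (fun f => f ^+ (p ^ l)) (fun f g => exprDn_pchar f g pn)
      (_ : 0 ^+ (p ^ l) = 0)); last by rewrite expr0n expn_eq0 (gtn_eqF p0).
    by apply: eq_bigr => x _; rewrite exprZn mpolyXn.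
  apply: homog_modsum_sum => x m /msuppZ_le; rewrite msuppX inE => /eqP ->.
  rewrite mdegMn mdeg1 mul1n; split=> //.
  by rewrite /modsum big1 // => i _; rewrite mulmnE modnMl.
rewrite {1 3}(divn_eq e (p ^ l)) exprD mulnC exprM.
have := homog_modsumM (homog_modsumX (e := (e %/ p ^ l)%N) hLq)
  (homog_modsumX (e := (e %% p ^ l)%N) hL).
by rewrite muln0 !muln1 add0n mulnC.
Qed.

(** Each [x_i^(b i)] becomes a power of a linear form, and the bounds [b i %% p ^ l] add up. *)
Lemma gl_act_monomial (F : fieldType) (p n l : nat) (g : 'M[F]_n) (b : 'X_{1..n}) :
  p \in [pchar F] ->
  homog_modsum p l (mdeg b) (modsum p l b) (gl_act g 'X_[b]).
Proof.
move=> hp; rewrite /gl_act comp_mpolyX mdegE /modsum.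
elim/big_rec3: _ => [|i d s f _ IH]; first exact: homog_modsum1.
by rewrite tnth_mktuple; apply: homog_modsumM => //; apply: homog_modsum_linearX.
Qed.

(** * Finiteness of minimal monomials *)

Lemma dickson (n : nat) (J : 'X_{1..n} -> Prop) :
  exists2 s : seq 'X_{1..n}, (forall m, m \in s -> J m) &
    forall m, J m -> exists2 m', m' \in s & (m' <= m)%MM.
Proof.
(* Induction on the number [c] of coordinates compared. *)
suff H c : forall J : 'X_{1..n} -> Prop,
    exists2 s : seq 'X_{1..n}, (forall m, m \in s -> J m) & forall m, J m ->
      exists2 m', m' \in s & forall i : 'I_n, (i < c)%N -> (m' i <= m i)%N.
  have [s sJ Js] := H n J; exists s => // m /Js[m' m's le].
  by exists m' => //; apply/mnm_lepP => i; apply: le.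
elim: c => [|c IH] {}J.
  have [[m Jm]|nJ] := classic (exists m, J m).
    by exists [:: m] => [m'|m' _]; [rewrite inE => /eqP -> | exists m; rewrite ?mem_head].
  by exists [::] => // m Jm; case: nJ; exists m.
have [cn|nc] := ltnP c n; last first.
  have [s sJ Js] := IH J; exists s => // m /Js[m' m's le]; exists m' => // i _.
  exact: le (leq_trans (ltn_ord i) nc).
pose ic := Ordinal cn.
have [s sJ Js] := IH J.
(* If [m ic] reaches the maximum over [s], then [s] suffices. Below it only finitely many values [N]
   remain, and the induction hypothesis covers each slice. *)
have [t tJ Jt] : exists2 t : seq 'X_{1..n}, (forall m, m \in t -> J m) &
    forall m, J m -> (m ic < \max_(m' <- s) m' ic)%N ->
    exists2 m', m' \in t & forall i : 'I_n, (i < c.+1)%N -> (m' i <= m i)%N.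
  elim: (\max_(m' <- s) _)%N => [|N [t tJ Jt]]; first by exists [::].
  have [u uJ Ju] := IH (fun m => J m /\ m ic = N).
  exists (t ++ u) => [m|m Jm]; first by rewrite mem_cat => /orP[/tJ|/uJ[]].
  rewrite ltnS leq_eqVlt => /orP[/eqP mN|/(Jt m Jm)[m' m't le]]; last first.
    by exists m' => //; rewrite mem_cat m't.
  have [m' m'u le] := Ju m (conj Jm mN); have [_ m'N] := uJ _ m'u.
  exists m'; first by rewrite mem_cat m'u orbT.
  move=> i; rewrite ltnS leq_eqVlt => /orP[/eqP ic'|/le //].
  by have -> : i = ic by [apply: val_inj]; rewrite m'N mN.
exists (s ++ t) => [m|m Jm]; first by rewrite mem_cat => /orP[/sJ|/tJ].
have [/(Jt m Jm)[m' m't le]|le] := ltnP (m ic) (\max_(m' <- s) m' ic)%N.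
  by exists m' => //; rewrite mem_cat m't orbT.
have [m' m's le'] := Js m Jm; exists m'; first by rewrite mem_cat m's.
move=> i; rewrite ltnS leq_eqVlt => /orP[/eqP ic'|/le' //].
have -> : i = ic by apply: val_inj.
by apply: leq_trans le; rewrite (big_rem m') //= leq_maxl.
Qed.

(** * Classification of the invariant ideals *)

Theorem theorem3 (k : closedFieldType) (p : nat) (hp : p \in [pchar k])
    (n : nat) (I : {mpoly k[n]} -> Prop) :
  is_ideal I ->
  (gl_invariant I <->
   exists B : seq (nat * seq nat),
     (forall dc, dc \in B -> is_carry_pattern p n dc.1 dc.2) /\
     (forall f, I f <-> I_B p B f)).
Proof.
move=> idI; have p1 := prime_gt1 (pcharf_prime hp).
split=> [inv|[B [_ IB]] g _ f /IB].
  (* Every monomial of [I] is a multiple of one in [s]; the carry patterns of [s] form [B]. *)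
  have [s sI Is] := dickson (fun m => I 'X_[m]).
  exists [seq (mdeg m, carry_pattern p m) | m <- s]; split.
    by move=> _ /mapP[m _ ->]; exists m.
  move=> f; split=> [If|].
    rewrite [f]mpolyE; apply: ideal_sum; first exact: ideal_gen_ideal.
    move=> m mf; apply: idealZ; first exact: ideal_gen_ideal.
    have [m' m's le] := Is m (gl_invariant_monomial idI inv If mf).
    rewrite -(submK le) mpolyXD.
    have [_ _ IM] : is_ideal
        (@I_B k n p [seq (mdeg m, carry_pattern p m) | m <- s]).
      exact: ideal_gen_ideal.
    apply/IM/mem_ideal_gen; exists (mdeg m', carry_pattern p m').
      exact: map_f.
    apply: mem_ideal_gen; exists m'; split=> //.
    exact/carry_leP.
  apply: (ideal_gen_sub idI) => {f} f [_ /mapP[m ms ->]] /=.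
  apply: (ideal_gen_sub idI) => {f} f [b [db le ->]].
  apply: (move_reach p1 (gl_invariant_move_closed hp idI inv) (sI m ms) db).
  exact/carry_leP.
(* The preimage of [I] under [g] is an ideal, so it is enough to test the monomials generating the
   carry ideals. *)
pose J f := I (gl_act g f).
have idJ : is_ideal J.
  case: (idI) => I0 ID IM; split; first by rewrite /J /gl_act raddf0.
    by move=> f1 f2 h1 h2; rewrite /J /gl_act raddfD; apply: ID.
  by move=> f1 f2 h; rewrite /J /gl_act rmorphM; apply: IM.
apply: (ideal_gen_sub idJ) => {f} f [[d c] dcB] /=.
apply: (ideal_gen_sub idJ) => {f} f [b [db le ->]]; rewrite /J.
rewrite [gl_act _ _]mpolyE; apply: ideal_sum => // m mb; apply: idealZ => //.
apply/IB/mem_ideal_gen; exists (d, c) => //; apply: mem_ideal_gen.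
(* Any level would do here, as only the degree is extracted. *)
have [dm _] := gl_act_monomial 0 hp mb.
exists m; split=> //=; first by rewrite dm.
apply: carry_le_trans le; apply/carry_leP => // l.
by have [_] := gl_act_monomial l hp mb.
Qed.
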